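(* Let a price function $P:\mathbb{N}_{\ge 1}\to\mathbb{R}_{\ge 0}$ be given. All basic zone tariffs with respect to $P$ (on all PTNs with zone partitions) satisfy the no-elongation property if and only if $P$ is increasing.
   Context: ''Increasing'' means non-decreasing. A PTN is a finite, simple, connected, undirected graph $(V,E)$. A path is a finite sequence $(x_1,\dots,x_n)$, $n\ge 1$, of (not necessarily distinct) nodes with consecutive nodes adjacent; $\mathcal{W}$ is the set of all paths; $[x_i,x_j]$ denotes the subpath $(x_i,\dots,x_j)$. A fare structure is a function $p:\mathcal{W}\to\mathbb{R}_{\ge 0}$. A zone partition $\mathcal{Z}$ is a partition of $V$ into nonempty sets called zones. The zone border weight of an edge $e=\{x,y\}$ is $b(e)=0$ if $x,y$ lie in the same zone and $b(e)=1$ otherwise. For a path $W=(x_1,\dots,x_n)$ put $z(W)=1+\sum_{i=1}^{n-1}b(x_i,x_{i+1})$. A fare structure $p$ is a basic zone tariff with respect to $P$ if $p(W)=P(z(W))$ for all $W\in\mathcal{W}$. No-elongation property: $p([x_1,x_{n-1}])\le p([x_1,x_n])$ for all paths $(x_1,\dots,x_n)\in\mathcal{W}$, $n\ge 2$. *)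

(* Defs.v *)
From mathcomp Require Import all_boot all_order all_algebra.
From mathcomp Require Import reals interval_inference.

Set Implicit Arguments.
Unset Strict Implicit.
Unset Printing Implicit Defensive.

Record ptn := PTN {
  node :> finType;
  adj : rel node;
  adj_sym : symmetric adj;
  adj_irr : irreflexive adj;
  adj_conn : forall x y : node, connect adj x y
}.

(* The path (x_1, ..., x_n), n >= 1, has first node x_1 and remaining nodes
   x_2, ..., x_n; nodes may repeat. *)
Record walk (G : ptn) := Walk {
  first : G;
  rest : seq G;
  walk_path : path (@adj G) first rest
}.

Definition nodes (G : ptn) (W : walk G) : seq G := first W :: rest W.

Lemma walk_init_subproof (G : ptn) (W : walk G) :
  path (@adj G) (first W) (take (size (rest W)).-1 (rest W)).
Proof. exact/take_path/walk_path. Qed.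

(* The subpath [x_1, x_{n-1}] of (x_1, ..., x_n); meaningful for n >= 2 only
   (a one-node path is left unchanged). *)
Definition walk_init (G : ptn) (W : walk G) : walk G :=
  Walk (walk_init_subproof W).

Definition fare_structure (R : realType) (G : ptn) : Type :=
  walk G -> {nonneg R}%R.

Definition no_elongation (R : realType) (G : ptn) (p : fare_structure R G) :
    Prop :=
  forall W : walk G, 2 <= size (nodes W) ->
    ((p (walk_init W))%:num <= (p W)%:num)%R.

Definition border (G : ptn) (Z : {set {set G}}) (x y : G) : nat :=
  if [exists A in Z, (x \in A) && (y \in A)] then 0 else 1.

Definition posnat : Type := {n : nat | 0 < n}.

(* nth (first W) (nodes W) i is x_{i+1}; the default value is never reached. *)
Definition zone_count (G : ptn) (Z : {set {set G}}) (W : walk G) : posnat :=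
  exist _ (1 + \sum_(i < (size (nodes W)).-1)
    border Z (nth (first W) (nodes W) i) (nth (first W) (nodes W) i.+1)) isT.

Definition basic_zone_tariff (R : realType) (P : posnat -> {nonneg R}%R)
    (G : ptn) (Z : {set {set G}}) (p : fare_structure R G) : Prop :=
  forall W : walk G, p W = P (zone_count Z W).

Definition increasing (R : realType) (P : posnat -> {nonneg R}%R) : Prop :=
  forall m n : posnat, sval m <= sval n -> ((P m)%:num <= (P n)%:num)%R.

(* Main.v *)
Require Import Defs.
From mathcomp Require Import all_boot all_order all_algebra.
From mathcomp Require Import reals interval_inference.

(** The number of crossed borders is a sum of nonnegative terms, one per edge of
the path, so removing the last node can only lower the zone count; an increasing
price function therefore never charges more for the shortened path
([zone_count_walk_init]).

Conversely, a single network tests all values of the price function: two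
adjacent nodes, each forming a zone of its own. Travelling back and forth between
them crosses a border at every step, so the path with [n] nodes counts [n] zones
([zone_count_link]). No-elongation applied to the path with [n + 2] nodes then
reads [P (n + 1) <= P (n + 2)], and these inequalities chain to monotonicity. *)

Lemma zone_count_walk_init (G : ptn) (Z : {set {set G}}) (W : walk G) :
  1 < size (nodes W) ->
  sval (zone_count Z (walk_init W)) <= sval (zone_count Z W).
Proof.
case: W => x s xs /=; case size_s: (size s) => [//|n] _.
rewrite leq_add2l size_takel ?size_s // big_ord_recr /=.
apply: leq_trans (leq_addr _ _); apply: leq_sum => i _.
have nth_init j : j <= n -> nth x (x :: take n s) j = nth x (x :: s) j.
  by case: j => //= j ltjn; rewrite nth_take.
rewrite /nodes /= size_s (nth_init i (ltnW (ltn_ord i))) (nth_take _ (ltn_ord i)).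
exact: leqnn.
Qed.

Definition singletons (T : finType) : {set {set T}} := [set [set x] | x : T].

Lemma singletons_partition (T : finType) : partition (singletons T) [set: T].
Proof.
apply/and3P; split.
- apply/eqP/setP => x; rewrite inE; apply/bigcupP.
  by exists [set x]; [exact: imset_f | rewrite inE].
- apply/trivIsetP => _ _ /imsetP[x _ ->] /imsetP[y _ ->] neq_xy.
  by rewrite disjoints1 inE; apply: contraNneq neq_xy => ->.
- by apply/imsetP => -[x _ /setP/(_ x)]; rewrite !inE eqxx.
Qed.

Lemma border_singletons (G : ptn) (x y : G) :
  border (singletons G) x y = (x != y).
Proof.
rewrite /border; case: existsP => [[A /and3P[/imsetP[z _ ->]]] | noA].
  by rewrite !inE => /eqP -> /eqP ->; rewrite eqxx.
case: eqP noA => // <- [].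
by exists [set x]; rewrite imset_f // !inE eqxx.
Qed.

(** Adjacent nodes are distinct, hence separated by a border. *)
Lemma zone_count_singletons (G : ptn) (W : walk G) :
  sval (zone_count (singletons G) W) = size (nodes W).
Proof.
case: W => x s xs /=; rewrite -[RHS]add1n -[in RHS](card_ord (size s)) -sum1_card.
congr (_ + _); apply: eq_bigr => i _; rewrite border_singletons.
have /pathP/(_ i (ltn_ord i)) := xs => /(_ x).
by case: eqP => //= ->; rewrite adj_irr.
Qed.

Lemma link_sym : symmetric (frel negb).
Proof. by case; case. Qed.

Lemma link_irr : irreflexive (frel negb).
Proof. by case. Qed.

Lemma link_conn (x y : bool) : connect (frel negb) x y.
Proof. by case: x; case: y; rewrite ?connect0 //; apply: connect1. Qed.

(** The complete graph on two nodes; adjacency is written as the graph of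
[negb] so that the iterates of [negb] form a path. *)
Definition link : ptn := PTN link_sym link_irr link_conn.

Definition shuttle (n : nat) : walk link :=
  @Walk link true (traject negb false n) (fpath_traject negb true n).

(** An equality of positive integers, not of their values, because [P] takes the
positivity proof as part of its argument. *)
Lemma zone_count_link (W : walk link) (k : posnat) :
  size (nodes W) = sval k -> zone_count (singletons link) W = k.
Proof. by move=> eqWk; apply: val_inj; rewrite /= -eqWk -zone_count_singletons. Qed.

Lemma increasing_succ (R : realType) (P : posnat -> {nonneg R}%R) :
  (forall n : nat, ((P (exist _ n.+1 isT))%:num
                    <= (P (exist _ n.+2 isT))%:num)%R) ->
  increasing P.
Proof.
move=> leP [[|m] // m_gt0] [[|n] // n_gt0] /= lemn.
rewrite (bool_irrelevance m_gt0 isT) (bool_irrelevance n_gt0 isT).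
pose f i := ((P (exist _ i.+1 isT))%:num)%R.
exact: (homo_leq (f := f) (@Order.le_refl _ _) (@Order.le_trans _ _) leP).
Qed.

Theorem theorem21 (R : realType) (P : posnat -> {nonneg R}%R) :
  (forall (G : ptn) (Z : {set {set G}}), partition Z [set: G] ->
     forall p : fare_structure R G,
       basic_zone_tariff P Z p -> no_elongation p)
  <-> increasing P.
Proof.
split=> [noel | incP G Z _ p pP W W_gt1]; last first.
  by rewrite !pP; apply/incP/zone_count_walk_init.
apply: increasing_succ => n.
have := noel link _ (singletons_partition link) _ (fun=> erefl) (shuttle n.+1).
rewrite (zone_count_link (shuttle n.+1) (exist _ n.+2 isT)); last first.
  by rewrite /= size_traject.
rewrite (zone_count_link (walk_init (shuttle n.+1)) (exist _ n.+1 isT)).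
  by apply.
by rewrite /= size_traject size_takel //= size_traject.
Qed.
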